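(* The following statements are equivalent for every graph $G$: (i) $G$ is $C_3$-pivot-minor-free. (ii) $G$ has no induced odd cycle. (iii) $G$ is bipartite.
   Context: Graphs are finite, without loops or multiple edges. $C_3$ is the cycle on three vertices; a cycle of length $3$ counts as an odd cycle. For a vertex $u$ of a graph $G$, the local complementation $G*u$ is obtained from $G$ by complementing the adjacency between every pair of distinct neighbours of $u$. For an edge $uv$ of $G$, the edge pivot is $G\wedge uv=((G*u)*v)*u$. A graph $G$ contains $H$ as a pivot-minor if $H$ can be obtained from $G$ by a sequence of vertex deletions and edge pivots; $G$ is $H$-pivot-minor-free if it contains no pivot-minor isomorphic to $H$. *)

(* Defs.v *)
From mathcomp Require Import all_boot.

Set Implicit Arguments.
Unset Strict Implicit.
Unset Printing Implicit Defensive.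

Record sgraph := SGraph {
  vertex :> finType;
  adj : rel vertex;
  adj_sym : symmetric adj;
  adj_irr : irreflexive adj }.

Definition isomorphic (G H : sgraph) : Prop :=
  exists2 f : G -> H, bijective f & forall x y, adj (f x) (f y) = adj x y.

Section Operations.
Variable G : sgraph.

Definition induced_adj (S : {set G}) : rel {x : G | x \in S} :=
  fun x y => adj (val x) (val y).

Lemma induced_sym (S : {set G}) : symmetric (@induced_adj S).
Proof. by move=> x y; apply: adj_sym. Qed.

Lemma induced_irr (S : {set G}) : irreflexive (@induced_adj S).
Proof. by move=> x; apply: adj_irr. Qed.

Definition induced (S : {set G}) : sgraph :=
  SGraph (@induced_sym S) (@induced_irr S).

Definition delete_vertex (u : G) : sgraph := induced [set~ u].

Definition local_complement_adj (u : G) : rel G := fun x y =>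
  if [&& x != y, adj u x & adj u y] then ~~ adj x y else adj x y.

Lemma local_complement_sym u : symmetric (local_complement_adj u).
Proof.
move=> x y; by rewrite /local_complement_adj eq_sym [adj u x && _]andbC (adj_sym x).
Qed.

Lemma local_complement_irr u : irreflexive (local_complement_adj u).
Proof. by move=> x; rewrite /local_complement_adj eqxx adj_irr. Qed.

Definition local_complement (u : G) : sgraph :=
  SGraph (@local_complement_sym u) (@local_complement_irr u).

End Operations.

(* Local complementation keeps the vertex type, so u and v are also vertices
   of the intermediate graphs. *)
Definition pivot (G : sgraph) (u v : G) : sgraph :=
  @local_complement (@local_complement (@local_complement G u) v) u.

Inductive pivot_reachable (G : sgraph) : sgraph -> Prop :=
| pivot_reachable_refl : pivot_reachable G G
| pivot_reachable_delete (K : sgraph) (u : K) :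
    pivot_reachable G K -> pivot_reachable G (delete_vertex u)
| pivot_reachable_pivot (K : sgraph) (u v : K) :
    adj u v -> pivot_reachable G K -> pivot_reachable G (pivot u v).

Definition has_pivot_minor (G H : sgraph) : Prop :=
  exists2 K, pivot_reachable G K & isomorphic K H.

Definition pivot_minor_free (H G : sgraph) : Prop := ~ has_pivot_minor G H.

(* For n >= 3 this is the cycle on n vertices; for n <= 2 it is complete. *)
Definition cycle_adj (n : nat) : rel 'I_n := fun i j =>
  (i != j) && ((i.+1 %% n == j) || (j.+1 %% n == i)).

Lemma cycle_sym n : symmetric (@cycle_adj n).
Proof. by move=> i j; rewrite /cycle_adj eq_sym orbC. Qed.

Lemma cycle_irr n : irreflexive (@cycle_adj n).
Proof. by move=> i; rewrite /cycle_adj eqxx. Qed.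

Definition cycle_graph (n : nat) : sgraph := SGraph (@cycle_sym n) (@cycle_irr n).

Definition has_induced_odd_cycle (G : sgraph) : Prop :=
  exists (n : nat) (S : {set G}),
    [/\ 3 <= n, odd n & isomorphic (induced S) (cycle_graph n)].

Definition independent (G : sgraph) (A : {set G}) : Prop :=
  {in A &, forall x y, ~~ adj x y}.

Definition bipartite (G : sgraph) : Prop :=
  exists2 A : {set G}, independent A & independent (~: A).

(* Main.v *)
(* An edge pivot exchanges the roles of its two ends in any proper 2-colouring,
   so bipartiteness passes to pivot-minors, and C_3 is not bipartite.
   Pivoting an edge of an induced cycle C_n and discarding its ends leaves an
   induced C_{n-2}, so an induced odd cycle yields C_3.  Finally, a graph without
   odd closed walks is bipartite, and a shortest odd closed walk is an induced
   cycle, since a repeated vertex or a chord splits it into two closed walks, one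
   of which is odd and shorter. *)
Require Import Defs.
From mathcomp Require Import all_boot.
From mathcomp Require Import zify.

Set Implicit Arguments.
Unset Strict Implicit.
Unset Printing Implicit Defensive.

(** * Induced subgraphs as pivot-minors *)

(** The map form of being an induced subgraph; it avoids subset types when the vertices are given by
    indices. *)
Definition embeds (H G : sgraph) : Prop :=
  exists2 f : H -> G, injective f & forall x y, adj (f x) (f y) = adj x y.

Lemma embeds_induced (G H : sgraph) (S : {set G}) :
  isomorphic (induced S) H -> embeds H G.
Proof.
case=> f [g fK gK] fadj; exists (fun x => val (g x)).
  by move=> x y /val_inj /(can_inj gK).
by move=> x y; rewrite -{2}(gK x) -{2}(gK y) fadj.
Qed.

Lemma induced_embeds (G H : sgraph) :
  embeds H G -> exists S : {set G}, isomorphic (induced S) H.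
Proof.
case=> f finj fadj; exists [set f x | x : H].
have memf x : f x \in [set f y | y : H] by apply: imset_f.
pose g x : induced [set f y | y : H] := exist _ (f x) (memf x).
have ginj : injective g by move=> x y [] /finj.
have gsurj (z : induced [set f y | y : H]) : z \in codom g.
  case: z => z zS; case/imsetP: (zS) => x _ zx.
  by apply/codomP; exists x; apply: val_inj.
exists (fun z => iinv (gsurj z)).
  exists g; first by move=> z; rewrite f_iinv.
  by move=> x; apply: ginj; rewrite f_iinv.
by move=> x y; rewrite -fadj -[in RHS](f_iinv (gsurj x)) -[in RHS](f_iinv (gsurj y)).
Qed.

Lemma pivot_reachable_trans (G K L : sgraph) :
  pivot_reachable G K -> pivot_reachable K L -> pivot_reachable G L.
Proof.
move=> GK; elim=> [//|M u _ GM|M u v uv _ GM].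
- exact: pivot_reachable_delete.
- exact: pivot_reachable_pivot.
Qed.

Lemma has_pivot_minor_trans (G K H : sgraph) :
  pivot_reachable G K -> has_pivot_minor K H -> has_pivot_minor G H.
Proof.
by move=> GK [L KL LH]; exists L => //; apply: pivot_reachable_trans KL.
Qed.

(** Vertices outside the image are deleted one at a time, by induction on a bound for the order of
    [G]; once none is left, the embedding is an isomorphism. *)
Lemma embeds_pivot_minor (H G : sgraph) : embeds H G -> has_pivot_minor G H.
Proof.
move: {2}#|G| (leqnn #|G|) => n; elim: n G => [|n IHn] G leGn [f finj fadj].
  have G0 (z : G) : False by have := fintype0 z; apply; apply/eqP; rewrite -leqn0.
  exists G; first exact: pivot_reachable_refl.
  exists (fun z => False_rect H (G0 z)); last by move=> z; case: (G0 z).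
  by exists f => z; [case: (G0 z) | case: (G0 (f z))].
have [/forallP fsurj|/forallPn /= [u fu]] := boolP [forall z, z \in codom f].
  exists G; first exact: pivot_reachable_refl.
  exists (fun z => iinv (fsurj z)).
    exists f; first by move=> z; rewrite f_iinv.
    by move=> x; apply: finj; rewrite f_iinv.
  by move=> x y; rewrite -fadj !f_iinv.
have delG : pivot_reachable G (delete_vertex u).
  exact/pivot_reachable_delete/pivot_reachable_refl.
apply: has_pivot_minor_trans delG _.
have memf x : f x \in [set~ u].
  by rewrite !inE; apply: contraNneq fu => <-; apply: codom_f.
apply: IHn.
  have := cardsC1 u; rewrite /= card_sig /= => cu.
  by rewrite -ltnS (leq_trans _ leGn) // cu prednK //; apply/card_gt0P; exists u.
exists (fun x => exist _ (f x) (memf x) : delete_vertex u) => //.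
by move=> x y [] /finj.
Qed.

(** * Adjacency after an edge pivot *)

Section Pivot.
Variables (G : sgraph) (u v : G).
Hypothesis uv : adj u v.

Let neq_uv : (u == v) = false.
Proof. by apply: contraTF uv => /eqP ->; rewrite adj_irr. Qed.

Let neq_vu : (v == u) = false.
Proof. by rewrite eq_sym neq_uv. Qed.

Let pivot_simpl := (eqxx, @adj_irr G, uv, adj_sym v u, neq_uv, neq_vu).

(** Over the two-element field this is the Schur complement of the block of [u] and [v] in the
    adjacency matrix. *)
Lemma pivot_adjE x y : x != u -> x != v -> y != u -> y != v ->
  @adj (pivot u v) x y =
    adj x y (+) ((adj u x && adj v y) (+) (adj v x && adj u y)).
Proof.
move=> xu xv yu yv; have [->|xy] := eqVneq x y.
  by rewrite !adj_irr [adj u y && _]andbC addbb.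
do 3!rewrite /= /local_complement_adj.
rewrite !pivot_simpl ![_ == x]eq_sym ![_ == y]eq_sym.
rewrite (negPf xu) (negPf xv) (negPf yu) (negPf yv) [y == x]eq_sym (negPf xy) /=.
by case: (adj u x); case: (adj u y); case: (adj v x); case: (adj v y);
   case: (adj x y).
Qed.

Lemma pivot_adj_left y : y != u -> y != v -> @adj (pivot u v) u y = adj v y.
Proof.
move=> yu yv; do 3!rewrite /= /local_complement_adj.
rewrite !pivot_simpl ![_ == y]eq_sym (negPf yu) (negPf yv) /=.
by case: (adj u y); case: (adj v y).
Qed.

Lemma pivot_adj_right y : y != u -> y != v -> @adj (pivot u v) v y = adj u y.
Proof.
move=> yu yv; do 3!rewrite /= /local_complement_adj.
rewrite !pivot_simpl ![_ == y]eq_sym (negPf yu) (negPf yv) /=.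
by case: (adj u y); case: (adj v y).
Qed.

End Pivot.

(** * Bipartiteness is inherited by pivot-minors *)

Lemma bipartiteP (G : sgraph) :
  bipartite G <-> exists c : G -> bool, forall x y, adj x y -> c x != c y.
Proof.
split=> [[A iA iCA]|[c cP]].
  exists (mem A) => x y; apply: contraTneq => /= Axy.
  have [xA|xA] := boolP (x \in A); first by apply: iA; rewrite // -Axy.
  by apply: iCA; rewrite inE // -Axy.
exists [set x | c x] => x y; rewrite !inE => cx cy; apply/negP => /cP.
  by rewrite cx cy.
by rewrite (negPf cx) (negPf cy).
Qed.

Lemma bipartite_delete (G : sgraph) (u : G) :
  bipartite G -> bipartite (delete_vertex u).
Proof.
move=> /bipartiteP [c cP]; apply/bipartiteP.
by exists (fun x => c (val x)) => x y; apply: cP.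
Qed.

Lemma bipartite_pivot (G : sgraph) (u v : G) :
  adj u v -> bipartite G -> bipartite (pivot u v).
Proof.
move=> uv /bipartiteP [c cP]; apply/bipartiteP.
exists (fun x : G => if x == u then c v else if x == v then c u else c x).
have cuv := cP _ _ uv.
move=> x y; have [->|xu] := eqVneq x u.
  have [->|yu] := eqVneq y u; first by rewrite adj_irr.
  have [_ _|yv] := eqVneq y v; first by rewrite eq_sym.
  by rewrite pivot_adj_left //; apply: cP.
have [->|xv] := eqVneq x v.
  have [//|yu] := eqVneq y u; have [->|yv] := eqVneq y v; first by rewrite adj_irr.
  by rewrite pivot_adj_right //; apply: cP.
have [->|yu] := eqVneq y u; first by rewrite adj_sym pivot_adj_left // adj_sym => /cP.
have [->|yv] := eqVneq y v; first by rewrite adj_sym pivot_adj_right // adj_sym => /cP.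
(* A toggled pair has one end adjacent to [u] and the other to [v]; as [u] and [v] differ in colour,
   so do its ends. *)
rewrite pivot_adjE //.
have cPb a b : adj a b ==> (c a != c b) by apply/implyP/cP.
move: (cPb x y) (cPb u x) (cPb v y) (cPb v x) (cPb u y) cuv.
by case: (@adj G x y); case: (adj u x); case: (adj v y); case: (adj v x);
   case: (adj u y); case: (c x); case: (c y); case: (c u); case: (c v).
Qed.

Lemma bipartite_reachable (G K : sgraph) :
  pivot_reachable G K -> bipartite G -> bipartite K.
Proof.
move=> GK bG; elim: GK => [//|L u _|L u v uv _].
- exact: bipartite_delete.
- exact: bipartite_pivot.
Qed.

Lemma C3_not_bipartite (K : sgraph) : isomorphic K (cycle_graph 3) -> ~ bipartite K.
Proof.
case=> f [g _ gK] fadj /bipartiteP [c cP].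
have tri (i j : 'I_3) : i != j -> c (g i) != c (g j).
  move=> ij; apply: cP; rewrite -fadj !gK.
  by case: i j ij => [[|[|[|]]]] // ? [[|[|[|]]]].
move: (tri ord0 (inord 1)) (tri ord0 (inord 2)) (tri (inord 1) (inord 2)).
rewrite -!val_eqE /= !inordK //.
case: (c (g ord0)); case: (c (g (inord 1))); case: (c (g (inord 2)));
  by move=> H1 H2 H3; move: (H1 isT) (H2 isT) (H3 isT).
Qed.

(** * Shortening induced cycles by pivots *)

(** Only [j.+1] can reach the modulus [n], so the remainders disappear and linear arithmetic
    applies. *)
Lemma cycle_adjE n (i j : 'I_n) : i < j ->
  cycle_adj i j = (j == i.+1 :> nat) || ((i == 0 :> nat) && (j.+1 == n)).
Proof.
move=> lt_ij; have jn := ltn_ord j; rewrite /cycle_adj -val_eqE /=.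
rewrite (ltn_eqF lt_ij) /= (modn_small (leq_ltn_trans lt_ij jn)) eq_sym.
congr (_ || _); have [jn1|jn1] := eqVneq j.+1 n.
  by rewrite jn1 modnn andbT eq_sym.
by rewrite modn_small ?andbF; lia.
Qed.

(* The pivot toggles only the pair {0, n-1}, which closes up the path left by
   the removal of the pivoted edge {n, n+1}. *)
Lemma embeds_cycle_pivot n (G : sgraph) : 3 <= n ->
  embeds (cycle_graph n.+2) G ->
  exists u v : G, adj u v /\ embeds (cycle_graph n) (pivot u v).
Proof.
move=> n3 [f finj fadj].
pose u := f (inord n.+1); pose v := f (inord n).
have eu : nat_of_ord (inord n.+1 : 'I_n.+2) = n.+1 by rewrite inordK.
have ev : nat_of_ord (inord n : 'I_n.+2) = n by rewrite inordK // leqW.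
have uv : adj u v.
  by rewrite adj_sym fadj /= cycle_adjE eu ev // eqxx.
exists u, v; split=> //.
have le_n : n <= n.+2 by lia.
pose h (i : 'I_n) : pivot u v := f (widen_ord le_n i).
have neq_u (i : 'I_n) : h i != u.
  by rewrite (inj_eq finj) -val_eqE /= eu; have := ltn_ord i; lia.
have neq_v (i : 'I_n) : h i != v.
  by rewrite (inj_eq finj) -val_eqE /= ev; have := ltn_ord i; lia.
have adju (i : 'I_n) : @adj G u (h i) = (i == 0 :> nat).
  rewrite adj_sym fadj /= cycle_adjE eu /=; have := ltn_ord i; lia.
have adjv (i : 'I_n) : @adj G v (h i) = (i.+1 == n :> nat).
  rewrite adj_sym fadj /= cycle_adjE ev /=; have := ltn_ord i; lia.
exists h; first by move=> i j /finj /(congr1 val) /= /val_inj.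
suff lt_adj (i j : 'I_n) : i < j -> adj (h i) (h j) = cycle_adj i j.
  move=> i j; case: (ltngtP i j) => [/lt_adj //|/lt_adj ji|/val_inj ->].
    by rewrite adj_sym ji; apply: cycle_sym.
  by rewrite !adj_irr.
(* As [n >= 3], the pair {0, n-1} is not consecutive, so the exclusive or with its toggle agrees
   with the disjunction in [cycle_adjE]. *)
move=> lt_ij; rewrite pivot_adjE // !adju !adjv fadj /= !cycle_adjE //=.
by have := ltn_ord i; have := ltn_ord j; lia.
Qed.

Lemma embeds_odd_cycle_C3 k (G : sgraph) :
  embeds (cycle_graph k.*2.+3) G -> has_pivot_minor G (cycle_graph 3).
Proof.
elim: k G => [|k IHk] G; first exact: embeds_pivot_minor.
case/embeds_cycle_pivot=> // u [v [uv /IHk]]; apply: has_pivot_minor_trans.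
exact/pivot_reachable_pivot/pivot_reachable_refl.
Qed.

(** * From odd closed walks to induced odd cycles *)

(** Only the values of [w] at 0, ..., n matter; a total function makes cutting and shifting plain
    index arithmetic. *)
Definition closed_walk (G : sgraph) (n : nat) (w : nat -> G) : Prop :=
  w n = w 0 /\ forall i, i < n -> adj (w i) (w i.+1).

(** The two lengths add up to [n], so for odd [n] exactly one is odd; both are below [n]. *)
Lemma closed_walk_repeat (G : sgraph) n (w : nat -> G) i j :
  closed_walk n w -> i < j < n -> w i = w j ->
  closed_walk (j - i) (fun k => w (i + k)) /\
  closed_walk (n - (j - i)) (fun k => if k <= i then w k else w (k + (j - i))).
Proof.
move=> [wn wS] /andP[lt_ij lt_jn] wij; split; split.
- by rewrite subnKC ?(ltnW lt_ij) // addn0 -wij.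
- by move=> k lt_k /=; rewrite addnS; apply: wS; lia.
- rewrite leq0n -wn; case: leqP => [|_]; first by lia.
  by congr w; lia.
move=> k lt_k /=; case: (ltngtP k i) => [lt_ki|lt_ik|->].
- by apply: wS; lia.
- by rewrite addSn; apply: wS; lia.
by rewrite addSn subnKC ?(ltnW lt_ij) // wij; apply: wS.
Qed.

(** Each walk uses the chord once, so the lengths add up to [n + 2]; both are below [n] exactly when
    [i] and [j] are not consecutive on the cycle. The predecessor in the second walk makes room for
    the chord between positions [i] and [i.+1]. *)
Lemma closed_walk_chord (G : sgraph) n (w : nat -> G) i j :
  closed_walk n w -> i < j < n -> adj (w i) (w j) ->
  closed_walk (j - i).+1 (fun k => if k <= j - i then w (i + k) else w i) /\
  closed_walk (n - (j - i)).+1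
    (fun k => if k <= i then w k else w (k.-1 + (j - i))).
Proof.
move=> [wn wS] /andP[lt_ij lt_jn] wij; split; split.
- by rewrite ltnn leq0n addn0.
- move=> k lt_k /=; have -> : k <= j - i by [].
  case: ltnP => [lt_kji|le_jik].
    by rewrite addnS; apply: wS; lia.
  have -> : i + k = j by lia.
  by rewrite adj_sym.
- rewrite leq0n -wn; case: ltnP => [|_]; first by lia.
  by congr w; lia.
move=> k lt_k /=; case: (ltngtP k i) => [lt_ki|lt_ik|->].
- by apply: wS; lia.
- have -> : k.+1.-1 + (j - i) = (k.-1 + (j - i)).+1 by lia.
  by apply: wS; lia.
by rewrite /= subnKC // ltnW.
Qed.

Lemma odd_closed_walk_embeds (G : sgraph) n (w : nat -> G) :
  odd n -> closed_walk n w ->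
  exists m, [/\ 3 <= m, odd m & embeds (cycle_graph m) G].
Proof.
move: {2}n (leqnn n) => b; elim: b n w => [|b IHb] n w; first by case: n.
move=> le_nb odd_n cw; have [wn wS] := cw.
have [/existsP[i /existsP[j /andP[lt_ij /eqP wij]]]|norep] := boolP
  [exists i : 'I_n, exists j : 'I_n, (i < j) && (w i == w j)].
  have lt_jn := ltn_ord j.
  have [] := closed_walk_repeat cw _ wij; first by rewrite lt_ij.
  have [odd_ji|even_ji] := boolP (odd (j - i)).
    by move=> cw1 _; apply: IHb cw1; lia.
  by move=> _ cw2; apply: IHb cw2; lia.
have [/existsP[i /existsP[j /and3P[lt_ij wij nc]]]|nochord] := boolP
  [exists i : 'I_n, exists j : 'I_n, [&& i < j, adj (w i) (w j) & ~~ cycle_adj i j]].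
  have lt_jn := ltn_ord j; rewrite cycle_adjE // in nc.
  have [] := closed_walk_chord cw _ wij; first by rewrite lt_ij.
  (* The chord adds one to each length, so the choice by parity is the reverse of that for a
     repeated vertex. *)
  have [odd_ji|even_ji] := boolP (odd (j - i)).
    by move=> _ cw2; apply: IHb cw2; lia.
  by move=> cw1 _; apply: IHb cw1; lia.
have n3 : 3 <= n.
  case: n odd_n wn wS {le_nb cw norep nochord} => [|[|[|n]]] // _ w1 wS.
  by have := wS 0 isT; rewrite w1 adj_irr.
exists n; split=> //; exists (fun i : 'I_n => w i).
  move=> i j wij; apply: val_inj => /=; case: (ltngtP i j) => // lt_ij; case/negP: norep.
    by apply/existsP; exists i; apply/existsP; exists j; rewrite lt_ij wij eqxx.
  by apply/existsP; exists j; apply/existsP; exists i; rewrite lt_ij wij eqxx.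
suff lt_adj (i j : 'I_n) : i < j -> adj (w i) (w j) = cycle_adj i j.
  move=> i j; case: (ltngtP i j) => [/lt_adj //|/lt_adj ji|/val_inj ->].
    by rewrite adj_sym ji; apply: cycle_sym.
  by rewrite !adj_irr.
move=> lt_ij; have [|nc] := boolP (cycle_adj i j).
  rewrite cycle_adjE // => /orP[/eqP ->|/andP[/eqP i0 /eqP jn]].
    by apply: wS; apply: ltn_ord.
  by rewrite i0 adj_sym; have := wS j (ltn_ord j); rewrite jn wn.
apply: contraNF nochord => wij.
by apply/existsP; exists i; apply/existsP; exists j; rewrite lt_ij wij nc.
Qed.

(** * Two-colouring through the bipartite double cover *)

(** The bipartite double cover of [G]: the second component, the sheet, records the parity of a
    walk, so a path from [(x, false)] to [(x, true)] is an odd closed walk at [x]. *)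
Definition double_adj (G : sgraph) : rel (G * bool) :=
  fun x y => adj x.1 y.1 && (x.2 != y.2).

Lemma double_connect_sym (G : sgraph) : connect_sym (@double_adj G).
Proof. by apply: sym_connect_sym => x y; rewrite /double_adj adj_sym eq_sym. Qed.

(** Exchanging the sheets is an automorphism of the cover. *)
Lemma double_connect_flip (G : sgraph) (x y : G) b c :
  connect (@double_adj G) (x, b) (y, c) ->
  connect (@double_adj G) (x, ~~ b) (y, ~~ c).
Proof.
case/connectP=> p pp yE.
apply/connectP; exists (map (fun z => (z.1, ~~ z.2)) p).
  elim: p x b pp {yE} => [//|[z d] p IHp] x b /= /andP[xz /IHp ->].
  by move: xz; rewrite /double_adj /= andbT; case: b d => [] [].
by rewrite -[(x, ~~ b)]/((fun z => (z.1, ~~ z.2)) (x, b)) last_map -yE.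
Qed.

Lemma double_connect_odd_walk (G : sgraph) (x : G) :
  connect (@double_adj G) (x, false) (x, true) ->
  exists n w, odd n /\ @closed_walk G n w.
Proof.
case/connectP=> p /(pathP (x, false)) pp lastp.
pose z k := nth (x, false) ((x, false) :: p) k.
have zlast : z (size p) = (x, true) by rewrite lastp (last_nth (x, false)).
have par k : k <= size p -> (z k).2 = odd k.
  elim: k => [//|k IHk] lt_k; have := pp k lt_k; case/andP=> _.
  rewrite -[nth _ (_ :: _) k]/(z k) -[nth _ _ k]/(z k.+1) (IHk (ltnW lt_k)) /=.
  by case: (odd k) (z k.+1).2 => [] [].
exists (size p), (fun k => (z k).1); split; first by rewrite -par // zlast.
split; first by rewrite zlast.
by move=> i lt_i; case/andP: (pp i lt_i).
Qed.

Lemma connect_double (G : sgraph) (x y : G) :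
  connect (@adj G) x y -> exists b, connect (@double_adj G) (x, false) (y, b).
Proof.
case/connectP=> p pp ->; elim/last_ind: p pp => [_|p z IHp].
  by exists false; apply: connect0.
rewrite rcons_path last_rcons => /andP[/IHp [b xb] yz].
exists (~~ b); apply: connect_trans xb (connect1 _).
by rewrite /double_adj /= yz; case: b.
Qed.

(* In each component, the colour class consists of the vertices reached by an
   even walk from the root. *)
Lemma no_odd_cycle_bipartite (G : sgraph) :
  ~ has_induced_odd_cycle G -> bipartite G.
Proof.
move=> noC.
have nodbl (x : G) : ~ connect (@double_adj G) (x, false) (x, true).
  case/double_connect_odd_walk=> n [w [odd_n /(odd_closed_walk_embeds odd_n)]].
  by case=> m [m3 odd_m /induced_embeds [S iS]]; apply: noC; exists m, S.
have csym : connect_sym (@adj G) by apply: sym_connect_sym; apply: adj_sym.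
pose r := root (@adj G); pose c x := connect (@double_adj G) (r x, false) (x, false).
apply/bipartiteP; exists c => x y xy.
have rxy : r x = r y by apply/eqP; rewrite root_connect // connect1.
have step b : connect (@double_adj G) (r y, false) (x, b) ->
              connect (@double_adj G) (r y, false) (y, ~~ b).
  by move=> cb; apply: connect_trans cb (connect1 _); rewrite /double_adj /= xy; case: b.
apply/negP => /eqP; rewrite /c rxy.
(* If both ends are even, [step] reaches [(y, true)], and the flipped path of [cy] leads back from
   there to [(r y, true)]. *)
have [cx /esym cy|ncx ncy] := boolP (connect _ _ (x, false)).
  apply: (nodbl (r y)); apply: connect_trans (step _ cx) _.
  by rewrite double_connect_sym; apply: (double_connect_flip cy).
(* If neither is even, [x] is still reached on some sheet; [true] would put [y] on sheet [false],
   against [ncy]. *)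
have [|b] := @connect_double G (r y) x; first by rewrite -rxy csym connect_root.
by case: b => [/step|]; rewrite ?(negPf ncx) //= -ncy.
Qed.

Theorem proposition5p1 (G : sgraph) :
  (pivot_minor_free (cycle_graph 3) G <-> ~ has_induced_odd_cycle G) /\
  (~ has_induced_odd_cycle G <-> bipartite G).
Proof.
have free_noC : pivot_minor_free (cycle_graph 3) G -> ~ has_induced_odd_cycle G.
  move=> free [n [S [n3 odd_n /embeds_induced Cn]]]; apply: free.
  have En : n = (n - 3)./2.*2.+3 by lia.
  by rewrite En in Cn; apply: embeds_odd_cycle_C3 Cn.
have bip_free : bipartite G -> pivot_minor_free (cycle_graph 3) G.
  by move=> bG [K GK /C3_not_bipartite]; apply; apply: bipartite_reachable bG.
(* This closes the cycle of implications (i) to (ii) to (iii) to (i). *)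
have noC_bip := @no_odd_cycle_bipartite G.
by split; split; auto.
Qed.
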